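(* Let $X=\{x_1<\dots<x_n\}\subset\mathbb{R}$ be finite. Suppose $X$ is not regular at $x_i$ because of some $x_l>x_i$ (i.e. neither condition (i) nor condition (ii) in the definition of regularity holds for the pair $x_i<x_l$), where $x_{i-1}\in X$ exists and is not fixed by $\Lambda_{(x_l-x_i)}$. Then there exists an interleaving whose induced matching has strictly larger height; that is, there exist $A(P_X)$-modules $I,M$, a translation $\Lambda\in\mathcal{T}(P_X)$ and a $(\Lambda,\Lambda)$-interleaving $(\phi,\psi)$ between $I$ and $M$ such that the induced matching $B(I)\to B(M)$ given by the triangle starting at $I$ is not an $h(\Lambda)$-matching.
   Context: Fix a field $K$ and $b>0$. **Setting.** $P_X$ is $X$ as a totally ordered set, $P_X^+=P_X\cup\{\infty\}$ with $p\le\infty$ for all $p$, with metric $d(x_i,x_j)=|x_i-x_j|$, $d(x_i,\infty)=x_n-x_i+b$. An $A(P_X)$-module is a functor from $P_X$ to finite-dimensional $K$-vector spaces, extended to $P_X^+$ by value $0$ at $\infty$. $\mathcal{T}(P_X)$ is the set of order-preserving $\Lambda:P_X^+\to P_X^+$ with $\Lambda p\ge p$; $h(\Lambda)=\max_p d(p,\Lambda p)$; $(M\Lambda)(p)=M(\Lambda p)$. For a height $\epsilon$ attained by some translation, $\Lambda_\epsilon$ is the unique maximal translation of height $\epsilon$, i.e. $\Lambda_\epsilon(p)=\max\{q\ge p:d(p,q)\le\epsilon\}$. A $(\Gamma,\Lambda)$-interleaving between $F,G$ is a pair $\phi:F\to G\Lambda$, $\psi:G\to F\Gamma$ such that $(\psi\Lambda)\circ\phi$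 and $(\phi\Gamma)\circ\psi$ have components $F(p\le\Gamma\Lambda p)$ and $G(p\le\Lambda\Gamma p)$ respectively. $D(F,G)$ is the infimum of $\epsilon$ such that a $(\Gamma,\Lambda)$-interleaving with $h(\Gamma),h(\Lambda)\le\epsilon$ exists. Indecomposables are, up to isomorphism, interval modules $I\sim[x,y]$ ($K$ on $[x,y]$ with identity maps, $0$ elsewhere). The width is $W(I)=\min\{\epsilon:\exists\Lambda,\Gamma\in\mathcal{T}(P_X),\,h(\Lambda),h(\Gamma)\le\epsilon,\ \mathrm{Hom}(I,I\Lambda\Gamma)=0\}$. $B(M)$ is the multiset of isomorphism classes of indecomposable summands of $M$. **Matchings.** A matching $S\to T$ of multisets is a bijection $f:S'\to T'$ between sub-multisets. It is an $\epsilon$-matching if all $s\in S$ with $W(s)>\epsilon$ are in $S'$, all $t\in T$ with $W(t)>\epsilon$ are in $T'$, and $D(s,f(s))\le\epsilon$ for all $s\in S'$. The height of a matching is the least $\epsilon$ for which it is an $\epsilon$-matching. **Induced matching.** For a surjection $q:M\to N$: for each $x\in X$, list the intervals of $B(M)$ with lower endpoint $x$, and those of $B(N)$ with lower endpoint $x$, with multiplicity, in order of reverse inclusion (largest first); the $j$-th interval of $B(N)$ is sent to the $j$-th interval of $B(M)$ (there are at least as many in $B(M)$). The union over $x$ is an injection $\Theta(q):B(N)\to B(M)$. For an injection $\iota:M\to N$: do the same with intervals having a common upper endpoint, listed largest first, sending the $j$-th interval of $B(M)$ to the $j$-th interval of $B(N)$; this gives an injection $\Theta(\iota):B(M)\to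 B(N)$. Given a $(\Lambda,\Lambda)$-interleaving with $\phi:I\to M\Lambda$, factor $\phi$ as $I\xrightarrow{q_\phi}\mathrm{im}(\phi)\xrightarrow{i_\phi}M\Lambda$. For $M=\bigoplus_tM_t$ with $M_t$ indecomposable, each $M_t\Lambda$ is zero or indecomposable; let $B(M,M\Lambda):B(M\Lambda)\to B(M)$ send $M_t\Lambda$ to $M_t$ whenever $M_t\Lambda\ne0$. The induced matching $B(I)\to B(M)$ given by the triangle starting at $I$ is $B(M,M\Lambda)\circ\Theta(i_\phi)\circ\Theta(q_\phi)^{-1}$. (Different listings of isomorphic copies give matchings that agree on isomorphism classes.) **Regularity.** $X$ is regular at $x_i$ if for all $x_l>x_i$ in $X$, either (i) $x_{l+2}-x_l>x_{i+1}-x_i$, or (ii) $x_{l+2}-x_l\le x_{i+1}-x_i$ and $x_{k+1}>x_{l+t}+x_l-x_i$, where $t$ is maximal such that $x_{l+t}-x_l\le x_{i+1}-x_i$, and $x_k=\Lambda_{(x_l-x_i)}(x_{l+1})$. Convention at the end of the poset: $x_{n+1}=\infty$, treated as the point $x_n+b$ in these inequalities; if $x_{l+2}$ does not exist, (i) is regarded as satisfied, and if $x_{k+1}$ does not exist, the inequality $x_{k+1}>x_{l+t}+x_l-x_i$ is regarded as satisfied. Equivalently, with $\Lambda=\Lambda_{(x_l-x_i)}$, (i) and (ii) both fail for the pair $x_i<x_l$ exactly when $x_{l+1}<\Lambda(x_{i+1})$ and $\Lambda(x_{l+1})<\Lambda^2(x_{i+1})$. *)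

(* Defs.v *)
From HB Require Import structures.
From mathcomp Require Import all_boot all_order all_algebra.
From mathcomp Require Import classical_sets reals.

Set Implicit Arguments.
Unset Strict Implicit.
Unset Printing Implicit Defensive.

Import Order.TTheory GRing.Theory Num.Theory.

Local Open Scope nat_scope.

(* A finite X = {x_1 < ... < x_n} is given as an increasing n-tuple of reals.
   P_X is 'I_n and P_X^+ is 'I_n.+1, with ord_max playing the role of oo;
   indices start at 0, so that x_k has index k - 1. *)

Section Poset.
Variable n : nat.

Definition pemb (i : 'I_n) : 'I_n.+1 := widen_ord (leqnSn n) i.

Record translation := Translation {
  trfun :> 'I_n.+1 -> 'I_n.+1;
  tr_mono : forall p q : 'I_n.+1, p <= q -> trfun p <= trfun q;
  tr_ge : forall p : 'I_n.+1, p <= trfun p }.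

Lemma tr_ge2 (G L : translation) (p : 'I_n.+1) : p <= G (L p).
Proof. exact: leq_trans (tr_ge L p) (tr_ge G (L p)). Qed.

End Poset.

Section Metric.
Variables (R : realType) (n : nat) (X : n.-tuple R) (b : R).

(* The real number attached to the k-th point; the index n (the point oo) gets
   x_n + b, so that the metric of P_X^+ is the one induced from R. *)
Definition pt (k : nat) : R := nth (last 0 X + b)%R X k.

Definition dist (p q : 'I_n.+1) : R := `|pt p - pt q|%R.

Definition height (L : translation n) : R :=
  \big[Num.max/0%R]_(p : 'I_n.+1) dist p (L p).

Definition Lmax (e : R) (p : 'I_n.+1) : 'I_n.+1 :=
  [arg max_(q > p | (p <= q) && (dist p q <= e)%R) (q : nat)].

(* Condition (i). The index l + 2 is that of a point of P_X^+ iff l + 2 <= n. *)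
Definition regular_i (i l : 'I_n) : Prop :=
  l.+2 <= n -> (pt l.+2 - pt l > pt i.+1 - pt i)%R.

Definition regular_t (i l : 'I_n) : nat :=
  \max_(t < (n - l).+1 | (pt (l + t) - pt l <= pt i.+1 - pt i)%R) t.

(* lift ord0 l is the point of index l + 1 in P_X^+. *)
Definition regular_k (i l : 'I_n) : 'I_n.+1 := Lmax (pt l - pt i)%R (lift ord0 l).

Definition regular_ii (i l : 'I_n) : Prop :=
  [/\ l.+2 <= n, (pt l.+2 - pt l <= pt i.+1 - pt i)%R
    & (regular_k i l).+1 <= n ->
      (pt (regular_k i l).+1 > pt (l + regular_t i l) + pt l - pt i)%R].

End Metric.

Section Modules.
Variables (K : fieldType) (n : nat).

(* A module is recorded as its extension to P_X^+. *)
Record pmod := PMod {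
  pobj :> 'I_n.+1 -> vectType K;
  pmor : forall p q : 'I_n.+1, p <= q -> 'Hom(pobj p, pobj q);
  pmor_id : forall (p : 'I_n.+1) (pp : p <= p), pmor pp = \1%VF;
  pmor_comp : forall (p q r : 'I_n.+1) (pq : p <= q) (qr : q <= r) (pr : p <= r),
    (pmor qr \o pmor pq)%VF = pmor pr;
  pobj_oo : \dim {: pobj ord_max} = 0 }.

Record pmorph (F G : pmod) := PMorph {
  papp :> forall p : 'I_n.+1, 'Hom(F p, G p);
  pnat : forall (p q : 'I_n.+1) (pq : p <= q),
    (papp q \o pmor F pq)%VF = (pmor G pq \o papp p)%VF }.

Definition piso (F G : pmod) : Prop :=
  exists (f : pmorph F G) (g : pmorph G F),
    forall p, (g p \o f p)%VF = \1%VF /\ (f p \o g p)%VF = \1%VF.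

Definition pzero (F : pmod) : Prop := forall p, \dim {: F p} = 0.

Definition hom_zero (F G : pmod) : Prop :=
  forall (f : pmorph F G) (p : 'I_n.+1), f p = 0%R.

Section Shift.
Variables (M : pmod) (L : translation n).

Lemma shift_id (p : 'I_n.+1) (pp : p <= p) : pmor M (tr_mono L pp) = \1%VF.
Proof. exact: pmor_id. Qed.

Lemma shift_comp (p q r : 'I_n.+1) (pq : p <= q) (qr : q <= r) (pr : p <= r) :
  (pmor M (tr_mono L qr) \o pmor M (tr_mono L pq))%VF = pmor M (tr_mono L pr).
Proof. exact: pmor_comp. Qed.

Lemma shift_oo : \dim {: M (L ord_max)} = 0.
Proof.
suff -> : L ord_max = ord_max by exact: pobj_oo.
by apply/val_inj/eqP; rewrite eqn_leq leq_ord (tr_ge L ord_max).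
Qed.

Definition shift : pmod := @PMod (fun p => M (L p))
  (fun p q pq => pmor M (tr_mono L pq)) shift_id shift_comp shift_oo.

End Shift.

Definition interleaving (G L : translation n) (E F : pmod)
    (phi : pmorph E (shift F L)) (psi : pmorph F (shift E G)) : Prop :=
  (forall p, (psi (L p) \o phi p)%VF = pmor E (tr_ge2 G L p)) /\
  (forall p, (phi (G p) \o psi p)%VF = pmor F (tr_ge2 L G p)).

Section Image.
Variables (F G : pmod) (f : pmorph F G).

Definition im_obj (p : 'I_n.+1) : vectType K := subvs_of (limg (f p)).

Definition im_mor (p q : 'I_n.+1) (pq : p <= q) : 'Hom(im_obj p, im_obj q) :=
  linfun (vsproj (limg (f q)) \o pmor G pq \o vsval).

Lemma im_morE (p q : 'I_n.+1) (pq : p <= q) (u : im_obj p) :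
  vsval (im_mor pq u) = pmor G pq (vsval u).
Proof.
rewrite lfunE /= vsprojK //.
have /memv_imgP[v _ ->] : vsval u \in limg (f p) by exact: subvsP.
by rewrite -comp_lfunE -pnat comp_lfunE memv_img ?memvf.
Qed.

Lemma im_id (p : 'I_n.+1) (pp : p <= p) : im_mor pp = \1%VF.
Proof. by apply/lfunP => u; apply: val_inj; rewrite /= im_morE pmor_id !id_lfunE. Qed.

Lemma im_comp (p q r : 'I_n.+1) (pq : p <= q) (qr : q <= r) (pr : p <= r) :
  (im_mor qr \o im_mor pq)%VF = im_mor pr.
Proof.
apply/lfunP => u; apply: val_inj.
by rewrite comp_lfunE /= !im_morE -comp_lfunE pmor_comp.
Qed.

Lemma im_oo : \dim {: im_obj ord_max} = 0.
Proof.
apply/eqP; rewrite dimvf /dim /= -leqn0 -(pobj_oo G).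
exact/dimvS/subvf.
Qed.

Definition pim : pmod := PMod im_id im_comp im_oo.

End Image.

(* M is the direct sum of the N t, as a biproduct. *)
Definition is_dsum (M : pmod) (T : finType) (N : T -> pmod) : Prop :=
  exists (inj : forall t, pmorph (N t) M) (proj : forall t, pmorph M (N t)),
    [/\ forall t p, (proj t p \o inj t p)%VF = \1%VF,
        forall s t p, s != t -> (proj t p \o inj s p)%VF = 0%R
      & forall p, (\sum_t (inj t p \o proj t p)%VF)%R = \1%VF].

(* The intervals [x, y] of P_X. *)
Definition pint : Type := {u : 'I_n * 'I_n | u.1 <= u.2}.

Definition ilo (J : pint) : 'I_n := (val J).1.
Definition ihi (J : pint) : 'I_n := (val J).2.
Definition in_int (J : pint) (p : 'I_n.+1) : bool := ilo J <= p <= ihi J.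
Definition sub_int (J J' : pint) : bool := (ilo J' <= ilo J) && (ihi J <= ihi J').

Section IntervalModule.
Variable J : pint.

(* K^1 inside the interval and K^0 outside; the transition maps are given by
   all-ones matrices, of size 1 x 1 (the identity) or empty. *)
Definition int_obj (p : 'I_n.+1) : vectType K := 'rV[K]_(in_int J p).

Definition int_mor (p q : 'I_n.+1) (pq : p <= q) : 'Hom(int_obj p, int_obj q) :=
  linfun (mulmxr (const_mx 1%R : 'M[K]_(in_int J p, in_int J q))).

Lemma int_id (p : 'I_n.+1) (pp : p <= p) : int_mor pp = \1%VF.
Proof.
apply/lfunP => u; rewrite id_lfunE lfunE /=; apply/rowP => k.
rewrite mxE (bigD1 k) //= big1 ?mxE ?mulr1 ?addr0 // => k'.
suff -> : k' = k by rewrite eqxx.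
by apply: val_inj; case: (in_int J p) k k' => -[[]] // ? [[]].
Qed.

Lemma int_comp (p q r : 'I_n.+1) (pq : p <= q) (qr : q <= r) (pr : p <= r) :
  (int_mor qr \o int_mor pq)%VF = int_mor pr.
Proof.
apply/lfunP => u; rewrite comp_lfunE !lfunE /= -mulmxA; congr (_ *m _)%R.
apply/matrixP => j k; rewrite !mxE.
have -> : in_int J q.
  have ord_in (c : bool) : 'I_c -> c by case: c => // -[].
  have /andP[Jp _] := ord_in _ j; have /andP[_ rJ] := ord_in _ k.
  by rewrite /in_int (leq_trans Jp pq) (leq_trans qr rJ).
by rewrite big_ord1 !mxE mulr1.
Qed.

Lemma int_oo : \dim {: int_obj ord_max} = 0.
Proof.
have E : in_int J ord_max = false.
  by apply/negbTE; rewrite /in_int negb_and -!ltnNge ltn_ord orbT.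
by rewrite dimvf /dim /= E.
Qed.

Definition intmod : pmod := PMod int_id int_comp int_oo.

End IntervalModule.

(* A multiset of intervals is a family indexed by a finite type. *)
Definition barcode (M : pmod) (T : finType) (J : T -> pint) : Prop :=
  is_dsum M (fun t => intmod (J t)).

End Modules.

Section Distance.
Variables (K : fieldType) (R : realType) (n : nat) (X : n.-tuple R) (b : R).

Local Open Scope classical_set_scope.

Definition D (F G : pmod K n) : R :=
  inf [set e | exists (Gam L : translation n)
      (phi : pmorph F (shift G L)) (psi : pmorph G (shift F Gam)),
      [/\ (height X b Gam <= e)%R, (height X b L <= e)%R
        & interleaving phi psi]].

(* The infimum is a minimum, there being finitely many heights. *)
Definition W (F : pmod K n) : R :=
  inf [set e | exists L Gam : translation n,
      [/\ (height X b L <= e)%R, (height X b Gam <= e)%R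
        & hom_zero F (shift (shift F L) Gam)]].

End Distance.

(* A bijection between a sub-multiset of S and a sub-multiset of T. *)
Record matching (S T : finType) := Matching {
  mfun :> S -> option T;
  mfun_inj : forall s s' t, mfun s = Some t -> mfun s' = Some t -> s = s' }.

Definition eps_matching (K : fieldType) (R : realType) (n : nat)
    (X : n.-tuple R) (b e : R) (S T : finType)
    (JS : S -> pint n) (JT : T -> pint n) (f : matching S T) : Prop :=
  [/\ forall s, (e < W X b (intmod K (JS s)))%R -> exists t, f s = Some t,
      forall t, (e < W X b (intmod K (JT t)))%R -> exists s, f s = Some t
    & forall s t, f s = Some t ->
        (D X b (intmod K (JS s)) (intmod K (JT t)) <= e)%R].

Section InducedMatching.
Variables (K : fieldType) (n : nat).

(* s enumerates, largest first, the members of the family with endpoint x;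
   the endpoint is the lower one for e := ilo, the upper one for e := ihi. *)
Definition listing (e : pint n -> 'I_n) (x : 'I_n) (T : finType)
    (J : T -> pint n) (s : seq T) : Prop :=
  [/\ uniq s, (forall t, (t \in s) = (e (J t) == x))
    & sorted (fun t t' => sub_int (J t') (J t)) s].

(* With e := ilo, theta is Theta(q) : B(N) -> B(M) for a surjection q : M -> N,
   where JU = B(N) and JV = B(M); with e := ihi, it is Theta(iota) : B(M) -> B(N)
   for an injection iota : M -> N, where JU = B(M) and JV = B(N). *)
Definition Theta (e : pint n -> 'I_n) (U V : finType)
    (JU : U -> pint n) (JV : V -> pint n) (theta : U -> V) : Prop :=
  forall x : 'I_n, exists (sU : seq U) (sV : seq V),
    [/\ listing e x JU sU, listing e x JV sV & prefix (map theta sU) sV].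

(* g is B(M, M L) : B(M L) -> B(M): the index set V of B(M L) corresponds to
   the nonzero M_t L. *)
Definition shift_matching (L : translation n) (V T : finType)
    (JV : V -> pint n) (JT : T -> pint n) (g : V -> T) : Prop :=
  [/\ injective g,
      forall v, piso (intmod K (JV v)) (shift (intmod K (JT (g v))) L)
    & forall t, ~ pzero (shift (intmod K (JT t)) L) -> exists v, g v = t].

(* f is an induced matching B(I) -> B(M), for some choice of the listings. *)
Definition induced_matching (I M : pmod K n) (L : translation n)
    (phi : pmorph I (shift M L)) (S T : finType)
    (JI : S -> pint n) (JM : T -> pint n) (f : matching S T) : Prop :=
  exists (U V : finType) (Jim : U -> pint n) (JML : V -> pint n)
      (thq : U -> S) (thi : U -> V) (g : V -> T),
    [/\ [/\ barcode I JI, barcode M JM, barcode (pim phi) Jim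
          & barcode (shift M L) JML],
        Theta (@ilo n) Jim JI thq, Theta (@ihi n) Jim JML thi,
        shift_matching L JML JM g
      & forall s t, f s = Some t <-> exists2 u, thq u = s & g (thi u) = t].

End InducedMatching.

(* Main.v *)
Require Import Defs.
From HB Require Import structures.
From mathcomp Require Import all_boot all_order all_algebra.
From mathcomp Require Import classical_sets reals.
From mathcomp Require Import zify lra.

(** Write e for x_l - x_i.  If neither regularity condition holds, there are
    indices l < z < y such that height e suffices to go from x_{i+1} to x_{z+1},
    from x_{l+1} to x_y and from x_{z+1} to x_{y+1}, but not from x_{l+1} to
    x_{y+1} ([irregular_gap]).  Hence there is a translation, called [jump] below,
    of height at most e, that sends x_{i-1} to x_i, x_i to x_l and all of
    ]x_i, x_l] to x_{z+1}; the first of these is possible because x_{i-1} is not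
    fixed by the maximal translation of height e.  As [jump] leaps from x_l to
    x_{z+1}, every interval that contains x_l and ends in [x_l, x_z] gets the upper
    endpoint x_i after the shift, and the induced matching can no longer tell these
    intervals apart except by their lower endpoints.

    This is exploited by I = [x_i, x_y] and by the direct sum M of a partner
    [x_l, x_z] and a decoy [x_i, x_l].  The module I is interleaved with the
    partner alone; this extends to M since the decoy dies under the square of
    [jump] ([interleaving_dsumr]).  The image of I in the shifted M is the simple
    interval [x_i, x_i], which is also the shifted partner, while the shifted
    decoy is the longer interval [x_{i-1}, x_i].  Among the intervals with upper
    endpoint x_i the decoy therefore comes first, and the induced matching sends
    I to the decoy.

    The distance from I to the decoy exceeds e ([D_gt]): for translations of
    height at most e, the nonzero map from I(x_i) to the value of I at the image
    of x_{l+1} would factor through the decoy at x_{l+1}, where it vanishes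
    ([interleaving_in_int]).

    An induced matching is formed from arbitrary interval decompositions of I, M,
    the image and the shifted M.  Only the set of the occurring intervals matters
    here, and this set does not depend on the decomposition: the identity of a
    summand factors through a sum over the other decomposition, some term of the
    sum is nonzero at the lower endpoint, and nonzero morphisms in both directions
    between two interval modules force the intervals to agree ([barcode_mem]). *)

Set Implicit Arguments.
Unset Strict Implicit.
Unset Printing Implicit Defensive.

Import Order.TTheory GRing.Theory Num.Theory.

Local Open Scope nat_scope.

(** * All-ones maps *)

Section Ones.
Variable K : fieldType.

(** All structure maps of interval modules, and all morphisms between them that
    are built below, are of this form; composites are then computed from the
    supports alone. *)
Definition ones (c d : bool) : 'Hom('rV[K]_c, 'rV[K]_d) :=
  linfun (mulmxr (const_mx 1%R : 'M[K]_(c, d))).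

Lemma ones_id c : ones c c = \1%VF.
Proof.
apply/lfunP => u; rewrite id_lfunE lfunE /=; apply/rowP => k; rewrite mxE.
by case: c u k => u k; [rewrite big_ord1 !ord1 mxE mulr1 | case: k].
Qed.

Lemma ones_comp (c d e : bool) :
  (c -> e -> d) -> (ones d e \o ones c d)%VF = ones c e.
Proof.
move=> cde; apply/lfunP => u; rewrite comp_lfunE !lfunE /= -mulmxA; congr (_ *m _)%R.
apply/matrixP => j k; rewrite !mxE.
have -> : d by apply: cde; [case: (c) j => -[] | case: (e) k => -[]].
by rewrite big_ord1 !mxE mulr1.
Qed.

Lemma ones0 (c d : bool) : ~~ (c && d) -> ones c d = 0%R.
Proof.
move=> cd; apply/lfunP => u; rewrite lfunE zero_lfunE /=; apply/rowP => k; rewrite !mxE.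
rewrite big1 // => j _; exfalso.
by case: c d cd u k j => -[] // _ _ [? ?] [].
Qed.

Lemma ones_neq0 (c d : bool) : c -> d -> ones c d != 0%R.
Proof.
move=> -> ->; rewrite ones_id; apply/eqP => /lfunP /(_ (const_mx 1%R)).
rewrite id_lfunE zero_lfunE => /rowP /(_ ord0); rewrite !mxE => /eqP.
by rewrite oner_eq0.
Qed.

(** Naturality of all-ones maps: only a square whose source and target are both
    nonzero can fail to commute, and it does so exactly when one path passes
    through a zero corner and the other does not. *)
Lemma ones_nat (ap aq bp bq : bool) :
  (ap -> bq -> aq = bp) ->
  (ones aq bq \o ones ap aq)%VF = (ones bp bq \o ones ap bp)%VF.
Proof.
move=> H; have [/andP[ha hb]|n] := boolP (ap && bq).
  by rewrite (H ha hb).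
case: ap H n => /= H n; last by rewrite (ones0 (c := false)) ?(ones0 (c := false) (d := bp)) ?comp_lfun0r.
by rewrite (ones0 (c := aq) (d := bq)) ?(ones0 (c := bp)) ?comp_lfun0l // (negbTE n) andbF.
Qed.

End Ones.

(** * Morphisms and direct sums of persistence modules *)

Section Pmorph.
Variables (K : fieldType) (n : nat).
Implicit Types (F G H : pmod K n) (L : translation n).

Lemma pmorph_comp_nat F G H (g : pmorph G H) (f : pmorph F G) (p q : 'I_n.+1) (pq : p <= q) :
  ((g q \o f q) \o pmor F pq)%VF = (pmor H pq \o (g p \o f p))%VF.
Proof. by rewrite -comp_lfunA (Defs.pnat f pq) comp_lfunA (Defs.pnat g pq) comp_lfunA. Qed.

Definition pmorph_comp F G H (g : pmorph G H) (f : pmorph F G) : pmorph F H :=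
  PMorph (pmorph_comp_nat g f).

Definition pmorph_shift F G (f : pmorph F G) L : pmorph (shift F L) (shift G L) :=
  @PMorph K n (shift F L) (shift G L) (fun p => f (L p))
    (fun p q pq => Defs.pnat f (tr_mono L pq)).

Lemma pmorph1_nat F (p q : 'I_n.+1) (pq : p <= q) :
  (\1 \o pmor F pq)%VF = (pmor F pq \o \1)%VF.
Proof. by rewrite comp_lfun1l comp_lfun1r. Qed.

Definition pmorph1 F : pmorph F F := PMorph (@pmorph1_nat F).

Lemma pmorph0_nat F G (p q : 'I_n.+1) (pq : p <= q) :
  ((0%R : 'Hom(F q, G q)) \o pmor F pq)%VF = (pmor G pq \o (0%R : 'Hom(F p, G p)))%VF.
Proof. by rewrite comp_lfun0l comp_lfun0r. Qed.

Definition pmorph0 F G : pmorph F G := PMorph (@pmorph0_nat F G).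

Lemma comp_lfunK (U V W : vectType K) (r : 'Hom(U, V)) (s : 'Hom(V, U))
    (r' : 'Hom(V, W)) (s' : 'Hom(W, V)) :
  (s' \o r')%VF = \1%VF -> (s \o r)%VF = \1%VF -> ((s \o s') \o (r' \o r))%VF = \1%VF.
Proof.
by move=> h' h; rewrite -comp_lfunA (comp_lfunA s') h' comp_lfun1l.
Qed.

Lemma dim0_hom0 (U V : vectType K) (f : 'Hom(U, V)) : \dim {: V} = 0 -> f = 0%R.
Proof.
move=> /eqP; rewrite dimv_eq0 => /eqP V0; apply/lfunP => u; rewrite zero_lfunE.
by apply/eqP; rewrite -memv0 -V0 memvf.
Qed.

End Pmorph.

Section DirectSum.
Variables (K : fieldType) (n : nat).

Section PairMap.
Variables (U V W : vectType K) (f : 'Hom(U, V)) (g : 'Hom(U, W)).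

Definition pair_fun (u : U) : (V * W)%type := (f u, g u).

Fact pair_fun_is_linear : linear pair_fun.
Proof. by move=> a u v; rewrite /pair_fun !linearP. Qed.

HB.instance Definition _ :=
  GRing.isLinear.Build K U (V * W)%type *:%R pair_fun pair_fun_is_linear.

Definition lpair : 'Hom(U, (V * W)%type) := linfun pair_fun.

Lemma lpairE u : lpair u = (f u, g u).
Proof. by rewrite lfunE. Qed.

End PairMap.

Definition lfst (V W : vectType K) : 'Hom((V * W)%type, V) := linfun fst.
Definition lsnd (V W : vectType K) : 'Hom((V * W)%type, W) := linfun snd.

Variables (F G : pmod K n).

Definition dsum_obj (p : 'I_n.+1) : vectType K := (F p * G p)%type.

Definition dsum_mor (p q : 'I_n.+1) (pq : p <= q) : 'Hom(dsum_obj p, dsum_obj q) :=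
  lpair (pmor F pq \o lfst (F p) (G p))%VF (pmor G pq \o lsnd (F p) (G p))%VF.

Lemma dsum_morE (p q : 'I_n.+1) (pq : p <= q) u :
  dsum_mor pq u = (pmor F pq u.1, pmor G pq u.2).
Proof. by rewrite lpairE !comp_lfunE !lfunE. Qed.

Lemma dsum_id (p : 'I_n.+1) (pp : p <= p) : dsum_mor pp = \1%VF.
Proof. by apply/lfunP => -[u v]; rewrite dsum_morE !pmor_id !id_lfunE. Qed.

Lemma dsum_comp (p q r : 'I_n.+1) (pq : p <= q) (qr : q <= r) (pr : p <= r) :
  (dsum_mor qr \o dsum_mor pq)%VF = dsum_mor pr.
Proof.
by apply/lfunP => u; rewrite comp_lfunE !dsum_morE /= -!comp_lfunE !pmor_comp.
Qed.

Lemma dsum_oo : \dim {: dsum_obj ord_max} = 0.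
Proof.
rewrite dimvf /dim /=; have := pobj_oo F; have := pobj_oo G; rewrite !dimvf.
by rewrite /dim => -> ->.
Qed.

Definition dsum : pmod K n := PMod dsum_id dsum_comp dsum_oo.

Lemma pmor_dsumE (p q : 'I_n.+1) (pq : p <= q) u :
  pmor dsum pq u = (pmor F pq u.1, pmor G pq u.2).
Proof. exact: dsum_morE. Qed.

Definition pinl : pmorph F dsum.
Proof.
apply: (@PMorph K n F dsum (fun p => lpair \1%VF (0%R : 'Hom(F p, G p)))) => p q pq.
by apply/lfunP => u; rewrite !comp_lfunE pmor_dsumE !lpairE /= !id_lfunE !zero_lfunE linear0.
Defined.

Definition pinr : pmorph G dsum.
Proof.
apply: (@PMorph K n G dsum (fun p => lpair (0%R : 'Hom(G p, F p)) \1%VF)) => p q pq.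
by apply/lfunP => u; rewrite !comp_lfunE pmor_dsumE !lpairE /= !id_lfunE !zero_lfunE linear0.
Defined.

Definition pfst : pmorph dsum F.
Proof.
apply: (@PMorph K n dsum F (fun p => lfst (F p) (G p))) => p q pq.
by apply/lfunP => u; rewrite !comp_lfunE pmor_dsumE !lfunE.
Defined.

Definition psnd : pmorph dsum G.
Proof.
apply: (@PMorph K n dsum G (fun p => lsnd (F p) (G p))) => p q pq.
by apply/lfunP => u; rewrite !comp_lfunE pmor_dsumE !lfunE.
Defined.

Lemma pfst_inl p : (pfst p \o pinl p)%VF = \1%VF.
Proof. by apply/lfunP => u; rewrite comp_lfunE lpairE lfunE /= ?id_lfunE ?zero_lfunE. Qed.

Lemma pfst_inr p : (pfst p \o pinr p)%VF = 0%R.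
Proof. by apply/lfunP => u; rewrite comp_lfunE lpairE lfunE /= ?id_lfunE ?zero_lfunE. Qed.

Lemma psnd_inl p : (psnd p \o pinl p)%VF = 0%R.
Proof. by apply/lfunP => u; rewrite comp_lfunE lpairE lfunE /= ?id_lfunE ?zero_lfunE. Qed.

Lemma psnd_inr p : (psnd p \o pinr p)%VF = \1%VF.
Proof. by apply/lfunP => u; rewrite comp_lfunE lpairE lfunE /= ?id_lfunE ?zero_lfunE. Qed.

Lemma dsum_sum p : ((pinl p \o pfst p)%VF + (pinr p \o psnd p)%VF)%R = \1%VF.
Proof.
apply/lfunP => -[u v]; rewrite add_lfunE !comp_lfunE !lpairE !id_lfunE !zero_lfunE.
by rewrite !lfunE /=; congr pair; rewrite ?addr0 ?add0r.
Qed.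

End DirectSum.

(** * Interval modules and uniqueness of their summands *)

Section Intervals.
Variables (K : fieldType) (n : nat).
Implicit Types (A B J : pint n) (L : translation n).

Lemma in_intE J (p : 'I_n.+1) : in_int J p = (ilo J <= p <= ihi J).
Proof. by []. Qed.

Lemma ilo_ihi J : ilo J <= ihi J.
Proof. exact: (valP J). Qed.

Lemma pint_eq A B : ilo A = ilo B :> nat -> ihi A = ihi B :> nat -> A = B.
Proof.
move=> lo hi; apply: val_inj; move: lo hi; rewrite /ilo /ihi.
by case: (val A) (val B) => [a a'] [c c'] /= /val_inj -> /val_inj ->.
Qed.

Lemma int_morE J (p q : 'I_n.+1) (pq : p <= q) :
  pmor (intmod K J) pq = ones K (in_int J p) (in_int J q).
Proof. by []. Qed.

(** If the lower endpoint of A lies below B, then the component at p factors through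
    the zero value of B there, as A(ilo A) maps onto A(p); dually, if the upper
    endpoint of B lies above A, the component factors through the zero value of A
    there. *)
Lemma int_hom_neq0 A B (f : pmorph (intmod K A) (intmod K B)) (p : 'I_n.+1) :
  f p != 0%R -> ilo B <= ilo A /\ ihi B <= ihi A.
Proof.
move=> fp; have fA : (f p \o ones K (in_int A p) (in_int A p))%VF = f p.
  by rewrite ones_id comp_lfun1r.
have fB : (ones K (in_int B p) (in_int B p) \o f p)%VF = f p.
  by rewrite ones_id comp_lfun1l.
have pA : in_int A p.
  by apply: contraNT fp => h; rewrite -fA ones0 ?comp_lfun0r // (negbTE h).
have pB : in_int B p.
  by apply: contraNT fp => h; rewrite -fB ones0 ?comp_lfun0l // (negbTE h).
have [/andP[loA hiA] /andP[loB hiB]] := (pA, pB).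
have [a1 b1] := (ilo_ihi A, ilo_ihi B).
split; apply: contraNT fp => h; apply/eqP.
- pose q := pemb (ilo A); have qp : q <= p by [].
  have qA : in_int A q by rewrite in_intE /=; lia.
  have qB : ~~ in_int B q by rewrite in_intE /=; lia.
  rewrite -fA -(ones_comp _ (d := in_int A q)) // comp_lfunA.
  have := Defs.pnat f qp; rewrite !int_morE => ->.
  by rewrite (ones0 _ (c := in_int B q)) ?(negbTE qB) // !comp_lfun0l.
- pose q := pemb (ihi B); have pq : p <= q by [].
  have qA : ~~ in_int A q by rewrite in_intE /=; lia.
  have qB : in_int B q by rewrite in_intE /=; lia.
  rewrite -fB -(ones_comp _ (d := in_int B q)) // -comp_lfunA.
  have := Defs.pnat f pq; rewrite !int_morE => <-.
  by rewrite (ones0 _ (d := in_int A q)) ?(negbTE qA) ?andbF // !comp_lfun0r.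
Qed.

(** The part of the Krull-Schmidt theorem that concerns the set of isomorphism
    classes of summands: the local ring argument reduces, for interval modules, to
    looking at one point of the interval. *)
Lemma barcode_mem (M : pmod K n) (T T' : finType) (J : T -> pint n) (J' : T' -> pint n) :
  barcode M J -> barcode M J' -> forall t, exists t', J' t' = J t.
Proof.
move=> [inj [proj [projK _ _]]] [inj' [proj' [_ _ sum1]]] t.
pose p := pemb (ilo (J t)).
have pJ : in_int (J t) p by rewrite in_intE /= leqnn ilo_ihi.
pose go t' := pmorph_comp (proj' t') (inj t); pose back t' := pmorph_comp (proj t) (inj' t').
(* The identity of J t at p is the sum over t' of these round trips. *)
have [t' nz|z] := pickP (fun t' => (back t' p \o go t' p)%VF != 0%R).
  have go0 : go t' p != 0%R.
    by apply: contraNneq nz => ->; rewrite comp_lfun0r.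
  have back0 : back t' p != 0%R.
    by apply: contraNneq nz => ->; rewrite comp_lfun0l.
  have [? ?] := int_hom_neq0 go0; have [? ?] := int_hom_neq0 back0.
  by exists t'; apply: pint_eq; apply/eqP; rewrite eqn_leq; apply/andP.
have := ones_neq0 K pJ pJ; rewrite ones_id => /eqP[].
have <- := projK t p.
apply/lfunP => v; rewrite zero_lfunE comp_lfunE -[inj t p v]id_lfunE -(sum1 p).
rewrite sum_lfunE linear_sum big1 // => t' _.
by have /negbFE/eqP/lfunP/(_ v) := z t'; rewrite !comp_lfunE zero_lfunE.
Qed.

Section ToShift.
Variables (A B : pint n) (L : translation n).

Definition to_shift
    (AB : forall p q : 'I_n.+1, p <= q ->
       in_int A p -> in_int B (L q) -> in_int A q = in_int B (L p)) :
    pmorph (intmod K A) (shift (intmod K B) L) :=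
  @PMorph K n (intmod K A) (shift (intmod K B) L)
    (fun p => ones K (in_int A p) (in_int B (L p)))
    (fun p q pq => ones_nat K (AB p q pq)).

Hypothesis AB : forall p : 'I_n.+1, in_int A p = in_int B (L p).

Definition shift_in : pmorph (intmod K A) (shift (intmod K B) L).
Proof. by apply: to_shift => p q pq; rewrite !AB => -> ->. Defined.

Definition shift_out : pmorph (shift (intmod K B) L) (intmod K A).
Proof.
apply: (@PMorph K n (shift (intmod K B) L) (intmod K A)
  (fun p => ones K (in_int B (L p)) (in_int A p))) => p q pq.
by apply: ones_nat; rewrite !AB => -> ->.
Defined.

Lemma shift_outK p : (shift_out p \o shift_in p)%VF = \1%VF.
Proof. by rewrite -(ones_id K (in_int A p)); apply: ones_comp; rewrite AB. Qed.

Lemma shift_inK p : (shift_in p \o shift_out p)%VF = \1%VF.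
Proof. by rewrite -(ones_id K (in_int B (L p))); apply: ones_comp; rewrite AB. Qed.

End ToShift.

(** The nonzero map from A(p) to A(G q) equals the composite of phi at p, the
    structure map of B from L p to q, and psi at q; so it factors through B(q). *)
Lemma interleaving_in_int A B (G L : translation n)
    (phi : pmorph (intmod K A) (shift (intmod K B) L))
    (psi : pmorph (intmod K B) (shift (intmod K A) G)) (p q : 'I_n.+1) :
  interleaving phi psi -> L p <= q -> in_int A p -> in_int A (G q) -> in_int B q.
Proof.
move=> [psiphi _] Lpq pA qA.
have pGq : p <= G q by exact: leq_trans (tr_ge2 G L p) (tr_mono G Lpq).
have : pmor (intmod K A) pGq != 0%R by exact: ones_neq0.
rewrite -(pmor_comp _ (tr_ge2 G L p) (tr_mono G Lpq)) -psiphi comp_lfunA.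
have := Defs.pnat psi Lpq => /= <-.
apply: contraNT => qB.
by rewrite [int_mor _ _ _]ones0 ?(negbTE qB) ?andbF // !(comp_lfun0l, comp_lfun0r).
Qed.

End Intervals.

(** * Decompositions, images and interleavings *)

Section Sums.
Variables (K : fieldType) (n : nat).

Lemma is_dsum_shift (M : pmod K n) (T : finType) (N : T -> pmod K n) (L : translation n) :
  is_dsum M N -> is_dsum (shift M L) (fun t => shift (N t) L).
Proof.
move=> [inj [proj [projK proj0 sum1]]].
exists (fun t => pmorph_shift (inj t) L), (fun t => pmorph_shift (proj t) L).
by split=> [t p|s t p|p] /=; [exact: projK|exact: proj0|exact: sum1].
Qed.

Lemma is_dsum_iso (M : pmod K n) (T : finType) (N N' : T -> pmod K n)
    (f : forall t, pmorph (N t) (N' t)) (g : forall t, pmorph (N' t) (N t)) :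
  (forall t p, (g t p \o f t p)%VF = \1%VF) ->
  (forall t p, (f t p \o g t p)%VF = \1%VF) ->
  is_dsum M N -> is_dsum M N'.
Proof.
move=> fK gK [inj [proj [projK proj0 sum1]]].
exists (fun t => pmorph_comp (inj t) (g t)), (fun t => pmorph_comp (f t) (proj t)).
split=> [t p|s t p st|p] /=.
- by rewrite -comp_lfunA (comp_lfunA (proj t p)) projK comp_lfun1l gK.
- by rewrite -comp_lfunA (comp_lfunA (proj t p)) proj0 // comp_lfun0l comp_lfun0r.
- rewrite -(sum1 p); apply: eq_bigr => t _.
  by rewrite -comp_lfunA (comp_lfunA (g t p)) fK comp_lfun1l.
Qed.

Lemma is_dsum_unit (F G : pmod K n) (f : pmorph F G) (g : pmorph G F) :
  (forall p, (g p \o f p)%VF = \1%VF) -> (forall p, (f p \o g p)%VF = \1%VF) ->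
  is_dsum G (fun _ : unit => F).
Proof.
move=> fK gK; exists (fun _ => f), (fun _ => g).
split=> [t p|[] [] p|p] //.
by rewrite (big_pred1 tt) => [|[]] //; exact: gK.
Qed.

Lemma is_dsum_bool (N : bool -> pmod K n) : is_dsum (dsum (N true) (N false)) N.
Proof.
exists (fun c => if c return pmorph (N c) (dsum (N true) (N false))
                 then pinl _ _ else pinr _ _).
exists (fun c => if c return pmorph (dsum (N true) (N false)) (N c)
                 then pfst _ _ else psnd _ _).
split=> [[] p|[] [] p|p] //; rewrite ?pfst_inl ?psnd_inr ?pfst_inr ?psnd_inl //.
by rewrite big_bool; exact: dsum_sum.
Qed.

(** The summand B, being interleaved with the zero module, can be added to C without
    disturbing an interleaving of A with C. *)
Lemma interleaving_dsumr (A B C : pmod K n) (G L : translation n)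
    (phi : pmorph A (shift C L)) (psi : pmorph C (shift A G)) :
  interleaving phi psi -> (forall p, pmor B (tr_ge2 L G p) = 0%R) ->
  @interleaving K n G L A (dsum B C)
    (pmorph_comp (pmorph_shift (pinr B C) L) phi) (pmorph_comp psi (psnd B C)).
Proof.
move=> [psiphi phipsi] B0; split=> p /=.
  have := psnd_inr B C (L p) => /= sK.
  by rewrite -comp_lfunA (comp_lfunA (lsnd _ _)) sK comp_lfun1l psiphi.
rewrite -comp_lfunA (comp_lfunA (phi (G p))) phipsi.
by apply/lfunP => -[u v]; rewrite dsum_morE B0 !comp_lfunE lpairE !lfunE.
Qed.

(** Identification of an image from an epi-mono factorization.  The pointwise
    sections e' and retractions m' need not be natural. *)
Section ImageFactor.
Variables (F G H : pmod K n) (f : pmorph F G) (e : pmorph F H) (m : pmorph H G).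
Variables (e' : forall p, 'Hom(H p, F p)) (m' : forall p, 'Hom(G p, H p)).
Hypothesis fE : forall p, f p = (m p \o e p)%VF.
Hypothesis eK : forall p, (e p \o e' p)%VF = \1%VF.
Hypothesis mK : forall p, (m' p \o m p)%VF = \1%VF.

Lemma factor_img p h : m p h \in limg (f p).
Proof.
have -> : m p h = f p (e' p h).
  by rewrite fE comp_lfunE -(comp_lfunE (e p)) eK id_lfunE.
exact/memv_img/memvf.
Qed.

Lemma factor_imgK p (u : pim f p) : m p (m' p (vsval u)) = vsval u.
Proof.
have /memv_imgP[v _ ->] : vsval u \in limg (f p) by exact: subvsP.
by rewrite fE comp_lfunE -(comp_lfunE (m' p)) mK id_lfunE.
Qed.

Definition to_pim : pmorph H (pim f).
Proof.
apply: (@PMorph K n H (pim f) (fun p => linfun (vsproj (limg (f p)) \o m p))) => p q pq.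
apply/lfunP => h; apply: val_inj; rewrite !comp_lfunE /= im_morE !lfunE /=.
by rewrite !vsprojK ?factor_img // -!comp_lfunE Defs.pnat.
Defined.

Definition of_pim : pmorph (pim f) H.
Proof.
apply: (@PMorph K n (pim f) H (fun p => linfun (m' p \o vsval))) => p q pq.
have lE r (w : pim f r) : linfun (m' r \o vsval) w = m' r (vsval w) by rewrite lfunE.
apply/lfunP => u; rewrite !comp_lfunE !lE /= im_morE -{1}(factor_imgK u).
rewrite -(comp_lfunE (pmor G pq)) -Defs.pnat comp_lfunE.
by rewrite -(comp_lfunE (m' q)) mK id_lfunE.
Defined.

Lemma to_pimK p : (of_pim p \o to_pim p)%VF = \1%VF.
Proof.
apply/lfunP => h; rewrite comp_lfunE !lfunE /= vsprojK ?factor_img //.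
by rewrite -comp_lfunE mK id_lfunE.
Qed.

Lemma of_pimK p : (to_pim p \o of_pim p)%VF = \1%VF.
Proof.
apply/lfunP => u; apply: val_inj; rewrite comp_lfunE id_lfunE !lfunE /=.
by rewrite vsprojK ?factor_img // factor_imgK.
Qed.

End ImageFactor.
End Sums.

(** * Lower bounds for the interleaving distance *)

Section DistanceBound.
Variables (K : fieldType) (R : realType) (n : nat) (X : n.-tuple R) (b : R).

Lemma const_oo_mono (p q : 'I_n.+1) : p <= q -> (ord_max : 'I_n.+1) <= (ord_max : 'I_n.+1).
Proof. by []. Qed.

(** This translation interleaves any two modules by zero maps, whence the set whose
    infimum is the interleaving distance is nonempty. *)
Definition tr_oo : translation n := Translation const_oo_mono (@leq_ord n).

Lemma dist_height (L : translation n) (p : 'I_n.+1) :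
  (dist X b p (L p) <= height X b L)%R.
Proof. exact: (le_bigmax _ (fun q : 'I_n.+1 => dist X b q (L q))). Qed.

Lemma D_ge (F G : pmod K n) (m : R) :
  (forall (Gam L : translation n)
     (phi : pmorph F (shift G L)) (psi : pmorph G (shift F Gam)),
     interleaving phi psi -> (height X b Gam < m)%R -> (height X b L < m)%R -> False) ->
  (m <= D X b F G)%R.
Proof.
move=> no; apply: lb_le_inf.
  exists (height X b tr_oo), tr_oo, tr_oo, (pmorph0 _ _), (pmorph0 _ _).
  split=> //; split=> p; rewrite comp_lfun0l;
  by apply/esym/dim0_hom0; apply: pobj_oo.
move=> e [Gam [L [phi [psi [hG hL int]]]]]; rewrite leNgt; apply/negP => em.
by apply: (no _ _ _ _ int); apply: le_lt_trans em.
Qed.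

End DistanceBound.

(** * The translation and the two modules *)

Section Jump.
Variables (K : fieldType) (n : nat) (i1 i l z y : 'I_n).
Hypotheses (i1i : i1.+1 = i :> nat) (il : i < l) (lz : l < z) (zy : z < y).

(** The leap from i |-> l to i + 1 |-> z + 1 makes the shifts of the decoy [i, l] and
    of the partner [l, z] both end at i.  The points of ]l, z] go to y, within the
    support [i, y] of I, and those above z go beyond it, so that the shift of I ends
    at z, exactly where the partner does. *)
Definition step (p : nat) : nat :=
  if p < i1 then p else if p == i1 then i : nat else if p == i then l : nat
  else if p <= l then z.+1 else if p <= z then y : nat else maxn p y.+1.

(** The case analysis is kept as a disjunction so that linear arithmetic can use it
    for several points at once. *)
Lemma stepP (p : nat) :
  (p < i1 /\ step p = p) \/ (p = i1 /\ step p = i) \/ (p = i /\ step p = l) \/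
  (i < p <= l /\ step p = z.+1) \/ (l < p <= z /\ step p = y) \/
  (z < p /\ step p = maxn p y.+1).
Proof. by rewrite /step; (do ![case: ifP => ?]); lia. Qed.

Lemma step_le (p : nat) : p <= n -> step p <= n.
Proof.
by move=> pn; have := stepP p; move: (ltn_ord i) (ltn_ord l) (ltn_ord y); lia.
Qed.

Definition jump_fun (p : 'I_n.+1) : 'I_n.+1 := inord (step p).

Lemma jump_funE p : jump_fun p = step p :> nat.
Proof. by rewrite inordK // ltnS step_le // -ltnS. Qed.

Lemma jump_mono (p q : 'I_n.+1) : p <= q -> jump_fun p <= jump_fun q.
Proof. by move=> pq; rewrite !jump_funE; move: (stepP p) (stepP q); lia. Qed.

Lemma jump_ge (p : 'I_n.+1) : p <= jump_fun p.
Proof. by rewrite jump_funE; move: (stepP p); lia. Qed.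

Definition jump : translation n := Translation jump_mono jump_ge.

Lemma jumpP (p : 'I_n.+1) :
  (p < i1 /\ jump p = p :> nat) \/ (p = i1 :> nat /\ jump p = i :> nat) \/
  (p = i :> nat /\ jump p = l :> nat) \/ (i < p <= l /\ jump p = z.+1 :> nat) \/
  (l < p <= z /\ jump p = y :> nat) \/ (z < p /\ jump p = maxn p y.+1 :> nat).
Proof. by rewrite jump_funE; exact: stepP. Qed.

Definition mkint (a c : 'I_n) (ac : a <= c) : pint n := exist _ (a, c) ac.

Fact i1_le_i : i1 <= i. Proof. by rewrite -i1i leqnSn. Qed.

Definition Ibar := mkint (ltnW (ltn_trans il (ltn_trans lz zy))).
Definition decoy := mkint (ltnW il).
Definition partner := mkint (ltnW lz).
(** The shift of the decoy. *)
Definition decoyS := mkint i1_le_i.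
(** Both the shift of the partner and the image of I. *)
Definition point_i := mkint (leqnn i).

Lemma IbarE p : in_int Ibar p = (i <= p <= y). Proof. by []. Qed.
Lemma decoyE p : in_int decoy p = (i <= p <= l). Proof. by []. Qed.
Lemma partnerE p : in_int partner p = (l <= p <= z). Proof. by []. Qed.
Lemma decoySE p : in_int decoyS p = (i1 <= p <= i). Proof. by []. Qed.
Lemma pointE p : in_int point_i p = (i <= p <= i). Proof. by []. Qed.

Definition intE := (IbarE, decoyE, partnerE, decoySE, pointE).

Lemma phi_cond (p q : 'I_n.+1) : p <= q -> in_int Ibar p -> in_int partner (jump q) ->
  in_int Ibar q = in_int partner (jump p).
Proof. by rewrite !intE; move: (jumpP p) (jumpP q); lia. Qed.

Lemma psi_cond (p q : 'I_n.+1) : p <= q -> in_int partner p -> in_int Ibar (jump q) ->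
  in_int partner q = in_int Ibar (jump p).
Proof. by rewrite !intE; move: (jumpP p) (jumpP q); lia. Qed.

Lemma point_cond (p : 'I_n.+1) : in_int point_i p = in_int partner (jump p).
Proof. by rewrite !intE; move: (jumpP p); lia. Qed.

Lemma decoyS_cond (p : 'I_n.+1) : in_int decoyS p = in_int decoy (jump p).
Proof. by rewrite !intE; move: (jumpP p); lia. Qed.

Definition Mmod : pmod K n := dsum (intmod K decoy) (intmod K partner).

Definition phi_partner : pmorph (intmod K Ibar) (shift (intmod K partner) jump) :=
  to_shift K phi_cond.

Definition psi_partner : pmorph (intmod K partner) (shift (intmod K Ibar) jump) :=
  to_shift K psi_cond.

Definition jump_phi : pmorph (intmod K Ibar) (shift Mmod jump) :=
  pmorph_comp (pmorph_shift (pinr _ _) jump) phi_partner.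

Definition jump_psi : pmorph Mmod (shift (intmod K Ibar) jump) :=
  pmorph_comp psi_partner (psnd _ _).

(** Both summands of M die under the square of [jump], and I survives it only at i,
    where the structure map passes through the partner at l. *)
Lemma jump_interleaving : interleaving jump_phi jump_psi.
Proof.
apply: interleaving_dsumr => [|p]; last first.
  apply: ones0; rewrite !intE; move: (jumpP p) (jumpP (jump p)); lia.
split=> p; apply: ones_comp; rewrite !intE;
  move: (jumpP p) (jumpP (jump p)) (jumpP (jump (jump p))); lia.
Qed.

Lemma barcode_I : barcode (intmod K Ibar) (fun _ : unit => Ibar).
Proof.
by apply: (is_dsum_unit (f := pmorph1 (intmod K Ibar)) (g := pmorph1 (intmod K Ibar))) => p /=;
  rewrite comp_lfun1l.
Qed.

Lemma barcode_M : barcode Mmod (fun c => if c then decoy else partner).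
Proof. exact: (is_dsum_bool (fun c : bool => intmod K (if c then decoy else partner))). Qed.

Lemma bar_shift_cond (c : bool) (p : 'I_n.+1) :
  in_int (if c then decoyS else point_i) p = in_int (if c then decoy else partner) (jump p).
Proof. by case: c; [exact: decoyS_cond | exact: point_cond]. Qed.

Lemma barcode_shiftM : barcode (shift Mmod jump) (fun c => if c then decoyS else point_i).
Proof.
apply: (is_dsum_iso (f := fun c => shift_out K (bar_shift_cond c))
  (g := fun c => shift_in K (bar_shift_cond c))) (is_dsum_shift jump barcode_M) => c p.
- exact: shift_inK.
- exact: shift_outK.
Qed.

Lemma I_to_point_cond (p q : 'I_n.+1) : p <= q ->
  in_int Ibar p -> in_int point_i q -> in_int Ibar q = in_int point_i p.
Proof. by rewrite !intE; lia. Qed.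

Definition I_to_point : pmorph (intmod K Ibar) (intmod K point_i) :=
  @PMorph K n (intmod K Ibar) (intmod K point_i)
    (fun p => ones K (in_int Ibar p) (in_int point_i p))
    (fun p q pq => ones_nat K (I_to_point_cond pq)).

Definition point_to_shiftM : pmorph (intmod K point_i) (shift Mmod jump) :=
  pmorph_comp (pmorph_shift (pinr _ _) jump) (shift_in K point_cond).

(** The supports of I and of the shifted partner meet in the single point i, through
    which [jump_phi] therefore factors. *)
Lemma barcode_im : barcode (pim jump_phi) (fun _ : unit => point_i).
Proof.
pose e' (p : 'I_n.+1) : 'Hom(intmod K point_i p, intmod K Ibar p) :=
  ones K (in_int point_i p) (in_int Ibar p).
pose m' (p : 'I_n.+1) : 'Hom(shift Mmod jump p, intmod K point_i p) :=
  (shift_out K point_cond p \o psnd (intmod K decoy) (intmod K partner) (jump p))%VF.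
have fE p : jump_phi p = (point_to_shiftM p \o I_to_point p)%VF.
  rewrite /= -comp_lfunA; congr (_ \o _)%VF; apply/esym/ones_comp.
  by rewrite -point_cond.
have eK p : (I_to_point p \o e' p)%VF = \1%VF.
  rewrite -(ones_id K (in_int point_i p)); apply: ones_comp; rewrite !intE; lia.
have mK p : (m' p \o point_to_shiftM p)%VF = \1%VF.
  exact: (comp_lfunK (psnd_inr _ _ (jump p)) (shift_outK K point_cond p)).
exact: is_dsum_unit (to_pimK fE eK mK) (of_pimK fE eK mK).
Qed.

Lemma jump_induced :
  exists f : matching unit bool,
    induced_matching jump_phi (fun _ : unit => Ibar) (fun c => if c then decoy else partner) f.
Proof.
have inj1 (s s' : unit) (t : bool) : Some true = Some t -> Some true = Some t -> s = s'.
  by case: s s' => -[].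
exists (Matching inj1), unit, bool, (fun _ => point_i), (fun c => if c then decoyS else point_i),
  id, (fun _ => true), id; split.
- by split; [exact: barcode_I|exact: barcode_M|exact: barcode_im|exact: barcode_shiftM].
- move=> x; exists (if i == x then [:: tt] else [::]), (if i == x then [:: tt] else [::]).
  split; first 2 last.
  + by rewrite map_id prefix_refl.
  + by split; [case: ifP|case; rewrite /ilo /=; case: ifP|case: ifP].
  + by split; [case: ifP|case; rewrite /ilo /=; case: ifP|case: ifP].
- move=> x; exists (if i == x then [:: tt] else [::]), (if i == x then [:: true; false] else [::]).
  split; first 2 last.
  + by case: ifP.
  + by split; [case: ifP|case; rewrite /ihi /=; case: ifP|case: ifP].
  + split; [by case: ifP|by case; rewrite /ihi /=; case: ifP|case: ifP => //= _].
    by rewrite /sub_int /ilo /ihi /= leqnn i1_le_i.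
- split=> [//|c|c _]; last by exists c.
  exists (shift_in K (bar_shift_cond c)), (shift_out K (bar_shift_cond c)) => p.
  by split; [exact: shift_outK|exact: shift_inK].
- move=> [] t; split=> [[<-]|[[] _ <-]] //=; by exists tt.
Qed.

(** Whatever listings are used, the first interval of the shifted M with upper
    endpoint i is the shifted decoy, being the largest one; and the decoy is the
    only summand of M whose shift is alive at i1. *)
Lemma induced_mismatch (S T : finType) (JI : S -> pint n) (JM : T -> pint n)
    (f : matching S T) :
  induced_matching jump_phi JI JM f ->
  exists s t, [/\ f s = Some t, JI s = Ibar & JM t = decoy].
Proof.
move=> [U [V [Jim [JML [thq [thi [g [[bI bM bim bML] _ Thi [_ giso _] fE]]]]]]]].
have [u Ju] := barcode_mem barcode_im bim tt.
have [v Jv] := barcode_mem barcode_shiftM bML true.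
have [sU [sV [[_ memU _] [_ memV srt] /prefixP[r rE]]]] := Thi i.
have uU : u \in sU by rewrite memU Ju /ihi eqxx.
have vV : v \in sV by rewrite memV Jv /ihi eqxx.
case: sU uU {memU} rE => [//|u0 sU] _ /= rE.
have top : JML (thi u0) = decoyS.
  have lo : ilo (JML (thi u0)) <= i1.
    move: vV srt; rewrite rE inE /= => /orP[/eqP <-|vr]; first by rewrite Jv.
    rewrite path_sortedE => [/andP[/allP/(_ v vr) /andP[h _] _]|].
      by rewrite Jv in h.
    move=> w2 w1 w3 /andP[h1 h2] /andP[h3 h4].
    by rewrite /sub_int (leq_trans h1 h3) (leq_trans h4 h2).
  have [[] E] := barcode_mem bML barcode_shiftM (thi u0); first by rewrite -E.
  by move: lo; rewrite -E /ilo /=; lia.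
exists (thq u0), (g (thi u0)); split.
- by apply/fE; exists u0.
- by have [[] <-] := barcode_mem bI barcode_I (thq u0).
have [[] E] := barcode_mem bM barcode_M (g (thi u0)); first by rewrite -E.
have [h [k hk]] := giso (thi u0); move: h k hk; rewrite top -E => h k hk.
have [kh _] := hk (pemb i1).
have in1 : in_int decoyS (pemb i1) by rewrite intE /=; lia.
have out1 : ~~ in_int partner (jump (pemb i1)).
  by rewrite intE; have := jumpP (pemb i1) => /=; lia.
have h0 : h (pemb i1) = 0%R.
  by apply: dim0_hom0; rewrite dimvf /dim /= (negbTE out1).
have := ones_neq0 K in1 in1; rewrite ones_id => /eqP[].
by rewrite -kh h0 comp_lfun0r.
Qed.

End Jump.

(** * Distances in the poset and failure of regularity *)

Section Metric.
Variables (R : realType) (n : nat) (X : n.-tuple R) (b : R).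
Hypotheses (b0 : (0 < b)%R) (Xs : sorted <%R X).

Lemma pt_lt (j k : nat) : j < k -> k <= n -> (pt X b j < pt X b k)%R.
Proof.
move=> jk; rewrite leq_eqVlt => /orP[/eqP kn|kn]; rewrite /pt; last first.
  by apply: (sorted_ltn_nth lt_trans) => //; rewrite inE size_tuple // (ltn_trans jk).
rewrite [X in (_ < X)%R]nth_default ?size_tuple ?kn //.
have Xn : nth (last 0 X + b)%R X n.-1 = last 0%R X.
  by rewrite -nth_last size_tuple; apply: set_nth_default; rewrite size_tuple; lia.
apply: (@le_lt_trans _ _ (last 0%R X)); last by rewrite ltrDl.
have Xs' : sorted <=%R X by apply: sub_sorted Xs => ? ?; exact: ltW.
rewrite -[X in (_ <= X)%R]Xn.
by apply: (sorted_leq_nth le_trans lexx _ Xs'); rewrite ?inE ?size_tuple; lia.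
Qed.

Lemma pt_le (j k : nat) : j <= k -> k <= n -> (pt X b j <= pt X b k)%R.
Proof. by rewrite leq_eqVlt => /orP[/eqP -> //|jk kn]; apply/ltW/pt_lt. Qed.

Lemma distE (p q : 'I_n.+1) : p <= q -> dist X b p q = (pt X b q - pt X b p)%R.
Proof.
move=> pq; rewrite /dist distrC ger0_norm // subr_ge0.
by apply: pt_le => //; rewrite -ltnS.
Qed.

Lemma LmaxP (e : R) (p : 'I_n.+1) : (0 <= e)%R ->
  [/\ p <= Lmax X b e p, (pt X b (Lmax X b e p) - pt X b p <= e)%R &
    forall q : 'I_n.+1, p <= q -> (pt X b q - pt X b p <= e)%R -> q <= Lmax X b e p].
Proof.
move=> e0; rewrite /Lmax; case: arg_maxnP => [|q /andP[pq de] qmax].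
  by rewrite leqnn distE // subrr.
split=> [//||q' pq' de']; first by rewrite -distE.
by apply: qmax; rewrite pq' distE.
Qed.

Section Height.
Variables (e : R) (i1 i l z y : 'I_n).
Hypotheses (i1i : i1.+1 = i :> nat) (il : i < l) (lz : l < z) (zy : z < y).
Hypotheses (e_i1 : (pt X b i - pt X b i1 <= e)%R) (e_i : (pt X b l - pt X b i <= e)%R).
Hypotheses (e_i2 : (pt X b z.+1 - pt X b i.+1 <= e)%R)
  (e_l : (pt X b y - pt X b l.+1 <= e)%R) (e_z : (pt X b y.+1 - pt X b z.+1 <= e)%R).

Lemma height_jump : (height X b (jump i1i il lz zy) <= e)%R.
Proof.
have e0 : (0 <= e)%R.
  by apply: le_trans e_i; rewrite subr_ge0 (pt_le (ltnW il)) // ltnW.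
suff dist_jump (p : 'I_n.+1) : (dist X b p (jump i1i il lz zy p) <= e)%R.
  by apply: bigmax_le => // p _; exact: dist_jump.
rewrite distE; last exact: tr_ge.
have yn := ltn_ord y; have pn : p <= n by rewrite -ltnS.
have [[_ ->]|[[-> ->]|[[-> ->]|[[pl ->]|[[pz ->]|[zp ->]]]]]] := jumpP i1i il lz zy p.
- by rewrite subrr.
- exact: e_i1.
- exact: e_i.
- by apply: le_trans e_i2; rewrite lerD2l lerN2 pt_le //; case/andP: pl.
- by apply: le_trans e_l; rewrite lerD2l lerN2 pt_le //; case/andP: pz.
- have [py|yp] := leqP y.+1 p; first by rewrite subrr.
  by apply: le_trans e_z; rewrite lerD2l lerN2 pt_le.
Qed.

End Height.

(** If D were at most e, there would be an interleaving by translations L and G with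
    L i <= l and G (l + 1) <= y, and then the decoy would be alive at l + 1.  The
    infimum stays away from e because the two distances that rule out larger values
    of L i and G (l + 1) have a minimum exceeding e. *)
Lemma D_gt (K : fieldType) (e : R) (i l z y : 'I_n) (il : i < l) (lz : l < z) (zy : z < y) :
  (e < pt X b l.+1 - pt X b i)%R -> (e < pt X b y.+1 - pt X b l.+1)%R ->
  (e < D X b (intmod K (Ibar il lz zy)) (intmod K (decoy il)))%R.
Proof.
move=> li yl.
apply: (@lt_le_trans _ _ (Num.min (pt X b l.+1 - pt X b i) (pt X b y.+1 - pt X b l.+1))%R).
  by rewrite lt_min li yl.
apply: D_ge => G L phi psi int; rewrite !lt_min => /andP[_ hG] /andP[hL _].
pose p := pemb i; pose q : 'I_n.+1 := lift ord0 l.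
have distL : dist X b p (L p) = (pt X b (L p) - pt X b i)%R by exact: distE (tr_ge L p).
have distG : dist X b q (G q) = (pt X b (G q) - pt X b l.+1)%R by exact: distE (tr_ge G q).
have Lp : L p <= q.
  rewrite leqNgt; apply/negP => lL.
  have := le_lt_trans (dist_height X b L p) hL; rewrite distL ltNge lerD2r.
  by rewrite (pt_le (ltnW lL) (leq_ord _)).
have Gq : G q <= y.
  rewrite leqNgt; apply/negP => yG.
  have := le_lt_trans (dist_height X b G q) hG; rewrite distG ltNge lerD2r.
  by rewrite (pt_le yG (leq_ord _)).
have pI : in_int (Ibar il lz zy) p.
  by rewrite IbarE /= leqnn (ltnW (ltn_trans il (ltn_trans lz zy))).
have GI : in_int (Ibar il lz zy) (G q).
  by rewrite IbarE Gq andbT (leq_trans _ (tr_ge G q)) //= ltnW // ltnS ltnW.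
by have := interleaving_in_int int Lp pI GI; rewrite decoyE /= ltnn andbF.
Qed.

(** The indices are y = k, where x_k is the maximal point within e of x_{l+1}, and
    z + 1 = l + t with t maximal as in the second regularity condition.  Failure of
    the first condition gives t >= 2, that is, l < z; maximality of k gives z < y. *)
Lemma irregular_gap (i l : 'I_n) : i < l -> ~ (regular_i X b i l \/ regular_ii X b i l) ->
  let e := (pt X b l - pt X b i)%R in
  exists z y : 'I_n,
    [/\ l < z /\ z < y, (pt X b z.+1 - pt X b i.+1 <= e)%R,
        (pt X b y.+1 - pt X b z.+1 <= e)%R
      & (pt X b y - pt X b l.+1 <= e < pt X b y.+1 - pt X b l.+1)%R].
Proof.
move=> il irr e.
have e0 : (0 <= e)%R by rewrite subr_ge0 pt_le // ltnW.
have ln : l.+2 <= n.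
  by rewrite ltnNge; apply/negP => nl; apply: irr; left; rewrite /regular_i ltnNge nl.
have gap : (pt X b l.+2 - pt X b l <= pt X b i.+1 - pt X b i)%R.
  by rewrite leNgt; apply/negP => h; apply: irr; left.
set t := regular_t X b i l; set k := regular_k X b i l.
have [kn kgap] : k < n /\ (pt X b k.+1 <= pt X b (l + t) + e)%R.
  have [kn|kn] := boolP (k < n); last first.
    by exfalso; apply: irr; right; split=> // h; rewrite h in kn.
  split=> //; rewrite leNgt; apply/negP => h; apply: irr; right; split=> // _.
  by rewrite -addrA.
have [t2 tn tgap] : [/\ 2 <= t, l + t <= n &
    (pt X b (l + t) - pt X b l <= pt X b i.+1 - pt X b i)%R].
  pose P (t : 'I_(n - l).+1) := (pt X b (l + t) - pt X b l <= pt X b i.+1 - pt X b i)%R.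
  have t2n : 2 < (n - l).+1 by rewrite ltnS ltn_subRL addnC add1n.
  have P2 : P (Ordinal t2n) by rewrite /P /= addn2.
  have [|t' Pt tE] := @eq_bigmax_cond _ P (fun t => t : nat).
    by apply/card_gt0P; exists (Ordinal t2n).
  rewrite /t /regular_t (_ : \max_(t < _ | _) t = t') //; split=> //.
    by rewrite -tE; exact: (leq_bigmax_cond (Ordinal t2n)).
  by rewrite -leq_subRL ?(ltnW (ltn_ord l)) // -ltnS.
have [lk kl kmax] : [/\ l < k, (pt X b k - pt X b l.+1 <= e)%R &
    forall q, l < q -> q <= n -> (pt X b q - pt X b l.+1 <= e)%R -> q <= k].
  have [? ? h] := LmaxP (lift ord0 l) e0; split=> // q lq qn.
  exact: (h (Ordinal (qn : q < n.+1))).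
have tk : l + t <= k.
  apply: kmax => //; first by rewrite -addn1 leq_add2l ltnW.
  by have := pt_le (ltnW il : i.+1 <= l.+1) (ltn_ord l); rewrite /e => ?; lra.
have zE : (l + t).-1.+1 = l + t by rewrite prednK // addn_gt0 (ltnW t2) orbT.
have zk : (l + t).-1 < k by rewrite zE.
exists (Ordinal (ltn_trans zk kn)), (Ordinal kn); rewrite /= zE; split=> //.
- by split; [rewrite -ltnS zE -addn2 leq_add2l | ].
- by rewrite /e; lra.
- by lra.
rewrite kl /= ltNge; apply/negP => h.
by have := kmax k.+1 (leqW lk) kn h; rewrite ltnn.
Qed.

End Metric.

Theorem proposition29 (K : fieldType) (R : realType) (n : nat)
    (X : n.-tuple R) (b : R) (i l i1 : 'I_n) :
  (0 < b)%R ->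
  sorted <%R X ->
  (i < l)%N ->
  ~ (regular_i X b i l \/ regular_ii X b i l) ->
  i1.+1 = i :> nat ->
  Lmax X b (pt X b l - pt X b i)%R (pemb i1) <> pemb i1 ->
  exists (I M : pmod K n) (L : translation n)
         (phi : pmorph I (shift M L)) (psi : pmorph M (shift I L)),
    interleaving phi psi /\
    (exists (S T : finType) (JI : S -> pint n) (JM : T -> pint n)
            (f : matching S T), induced_matching phi JI JM f) /\
    (forall (S T : finType) (JI : S -> pint n) (JM : T -> pint n)
            (f : matching S T),
       induced_matching phi JI JM f ->
       ~ eps_matching K X b (height X b L) JI JM f).
Proof.
move=> b0 Xs il irr i1i i1_moves.
have [z [y [[lz zy] e_i2 e_z /andP[e_l e_y]]]] := irregular_gap b0 Xs il irr.
set e := (pt X b l - pt X b i)%R in i1_moves e_i2 e_z e_l e_y.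
have e0 : (0 <= e)%R by rewrite subr_ge0 (pt_le b0 Xs) // ltnW.
have e_i1 : (pt X b i - pt X b i1 <= e)%R.
  rewrite leNgt; apply/negP => h; apply: i1_moves; apply/val_inj/eqP.
  have [i1_le near _] := LmaxP b0 Xs (pemb i1) e0.
  rewrite eqn_leq i1_le andbT leqNgt; apply/negP => moves.
  have : (pt X b i <= pt X b (Lmax X b e (pemb i1)))%R.
    by rewrite -i1i (pt_le b0 Xs moves (leq_ord _)).
  by move: near h; rewrite /= => ? ? ?; lra.
have e_l1 : (e < pt X b l.+1 - pt X b i)%R by rewrite ltrD2r pt_lt.
have hJ := height_jump b0 Xs i1i il lz zy e_i1 (lexx e) e_i2 e_l e_z.
exists (intmod K (Ibar il lz zy)), (Mmod K il lz), (jump i1i il lz zy).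
exists (jump_phi K i1i il lz zy), (jump_psi K i1i il lz zy).
split; first exact: jump_interleaving.
split; first by have [f] := jump_induced K i1i il lz zy; exists unit, bool; eauto.
move=> S T JI JM f ind [_ _ near].
have [s [t [fst Is Mt]]] := induced_mismatch ind.
have := near s t fst; rewrite Is Mt leNgt => /negP; apply.
exact: le_lt_trans hJ (D_gt b0 Xs K il lz zy e_l1 e_y).
Qed.
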